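(* Let $C\subset\mathbb{P}^2_R$ be a smooth plane curve of degree $d$ as in the context, $n\ge1$ with $n\ge d-2$, and $D=nC_\infty$. Then $$H^0(C,\mathcal{O}_C(D))=\Bigl(\bigoplus_{i+j\le n}R\,x^iy^j\Bigr)\Big/\Bigl(\bigoplus_{i+j\le n-d}R\,f\,x^iy^j\Bigr).$$
   Context: $R$ is the valuation ring of a finite extension of $\mathbb{Q}_p$, $F(X,Y,Z)\in R[X,Y,Z]$ is homogeneous of degree $d$ and defines a curve $C\subset\mathbb{P}^2_R$ smooth over $R$, with the reduction of $F$ modulo the maximal ideal not divisible by $Z$. $x=X/Z$, $y=Y/Z$, $f(x,y)=F(x,y,1)$, and $C_\infty=C\cdot\{Z=0\}$. Indices $i,j$ are non-negative integers; the identification is by restricting polynomials in $x,y$ to $C$. *)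

(* Defs.v *)
From HB Require Import structures.
From mathcomp Require Import all_boot all_order all_algebra all_field.
From mathcomp Require Import boolp ring.
From mathcomp Require Import mpoly.

Set Implicit Arguments.
Unset Strict Implicit.
Unset Printing Implicit Defensive.

Import Order.TTheory GRing.Theory Num.Theory.

Local Open Scope ring_scope.
Local Open Scope quotient_scope.

(* Additive valuations. The value at 0 should be read as +oo; the number
   [v 0] itself is junk and is never used. *)
Definition is_valuation (K : fieldType) (v : K -> rat) : Prop :=
  (forall x y, x != 0 -> y != 0 -> v (x * y) = v x + v y) /\
  (forall x y, x != 0 -> y != 0 -> x + y != 0 ->
     Num.min (v x) (v y) <= v (x + y)).

Definition rat_padic_val (p : nat) (q : rat) : rat :=
  (logn p `|numq q|)%:R - (logn p `|denq q|)%:R.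

Definition val_ge (K : fieldType) (v : K -> rat) (N : nat) (x : K) : Prop :=
  x = 0 \/ N%:R <= v x.

(* Q_p as the completion of Q: a field with a valuation that extends the
   p-adic valuation of Q, in which Q is dense and Cauchy sequences converge.
   This determines the field up to a unique isomorphism over Q. *)
Record padic_completion (p : nat) := PadicCompletion {
  padic_field :> fieldType;
  padic_incl : {rmorphism rat -> padic_field};
  padic_val : padic_field -> rat;
  padic_valP : is_valuation padic_val;
  padic_val_incl :
    forall q, q != 0 -> padic_val (padic_incl q) = rat_padic_val p q;
  padic_dense :
    forall x N, exists q, val_ge padic_val N (x - padic_incl q);
  padic_complete : forall u : nat -> padic_field,
    (forall N, exists k, forall i j, (k <= i)%N -> (k <= j)%N ->
       val_ge padic_val N (u i - u j)) ->
    exists l, forall N, exists k, forall i, (k <= i)%N ->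
       val_ge padic_val N (u i - l)
}.

(* A valuation on the finite extension L of Q_p that extends the p-adic one
   (it exists and is unique). *)
Record extended_valuation (p : nat) (K : padic_completion p)
    (L : fieldExtType (padic_field K)) := ExtendedValuation {
  ext_val :> L -> rat;
  ext_valP : is_valuation ext_val;
  ext_val_base : forall x : K, x != 0 -> ext_val x%:A = padic_val x
}.

Section ValuationRing.
Variables (p : nat) (K : padic_completion p).
Variables (L : fieldExtType (padic_field K)) (v : extended_valuation L).

Definition in_valuation_ring : {pred L} :=
  fun x => (x == 0) || (0 <= v x).

Lemma ext_val1 : v 1 = 0.
Proof.
have := (ext_valP v).1 1 1 (oner_neq0 _) (oner_neq0 _).
by rewrite mulr1 => h; apply: (addrI (v 1)); rewrite addr0 -h.
Qed.

Lemma ext_valN1 : v (-1) = 0.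
Proof.
have N1 : (-1 : L) != 0 by rewrite oppr_eq0 oner_eq0.
have := (ext_valP v).1 _ _ N1 N1.
rewrite mulrNN mulr1 ext_val1 => /esym/eqP.
by rewrite -mulr2n mulrn_eq0 /= => /eqP.
Qed.

Lemma in_valuation_ring_subring : subring_closed in_valuation_ring.
Proof.
have memM x y : in_valuation_ring x -> in_valuation_ring y ->
    in_valuation_ring (x * y).
  rewrite /in_valuation_ring /= mulf_eq0.
  case: eqVneq => //= x0 vx; case: eqVneq => //= y0 vy.
  by rewrite (ext_valP v).1 // addr_ge0.
have memN x : in_valuation_ring x -> in_valuation_ring (- x).
  rewrite -mulN1r; apply: memM.
  by rewrite /in_valuation_ring ext_valN1 lexx orbT.
have memD x y : in_valuation_ring x -> in_valuation_ring y ->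
    in_valuation_ring (x + y).
  case: (eqVneq x 0) => [->|x0]; first by rewrite add0r.
  case: (eqVneq y 0) => [->|y0]; first by rewrite addr0.
  rewrite /in_valuation_ring (negPf x0) (negPf y0) /= => vx vy.
  case: eqVneq => //= xy0; apply: le_trans ((ext_valP v).2 _ _ x0 y0 xy0).
  by rewrite le_min vx.
split=> [|x y hx hy|]; last exact: memM.
  by rewrite unfold_in /in_valuation_ring ext_val1 lexx orbT.
by apply: memD => //; apply: memN.
Qed.

HB.instance Definition _ :=
  GRing.isSubringClosed.Build L in_valuation_ring in_valuation_ring_subring.

Record valuation_ring := ValuationRing {
  valuation_ring_val : L;
  _ : valuation_ring_val \in in_valuation_ring
}.

HB.instance Definition _ := [isSub for valuation_ring_val].
HB.instance Definition _ := [Choice of valuation_ring by <:].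
HB.instance Definition _ := [SubChoice_isSubComNzRing of valuation_ring by <:].

Definition in_maximal_ideal (x : valuation_ring) : Prop :=
  \val x = 0 \/ 0 < v (\val x).

End ValuationRing.

(* {fraction A} is only available for an integral domain, and the integrality
   of a smooth plane curve C is a consequence, not part, of the hypotheses. When A is a domain this
   is its field of fractions. *)
Section TotalFractions.
Variable A : comNzRingType.

Record regular_pair := RegularPair {
  regular_pair_val : A * A;
  _ : `[< GRing.lreg regular_pair_val.2 >]
}.

HB.instance Definition _ := [isSub for regular_pair_val].
HB.instance Definition _ := [Choice of regular_pair by <:].

Implicit Types s t u : regular_pair.

Let num s := (regular_pair_val s).1.
Let den s := (regular_pair_val s).2.

Let den_reg s : GRing.lreg (den s).
Proof. by apply/asboolP; rewrite /den; case: s. Qed.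

Definition pair_over (a b : A) (hb : GRing.lreg b) : regular_pair :=
  @RegularPair (a, b) (introT (asboolP (GRing.lreg b)) hb).

Let numE a b (hb : GRing.lreg b) : num (pair_over a hb) = a. by []. Qed.
Let denE a b (hb : GRing.lreg b) : den (pair_over a hb) = b. by []. Qed.

Definition fequiv s t := num s * den t == num t * den s.

Let fequiv_refl : reflexive fequiv. Proof. by move=> s; rewrite /fequiv. Qed.
Let fequiv_sym s t : fequiv s t = fequiv t s.
Proof. by rewrite /fequiv eq_sym. Qed.
Let fequiv_trans : transitive fequiv.
Proof.
move=> t s u /eqP st /eqP tu; apply/eqP/(@den_reg t).
by rewrite mulrA [den t * _]mulrC st mulrAC tu; ring.
Qed.

Canonical fequiv_equiv := EquivRel fequiv fequiv_refl fequiv_sym fequiv_trans.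

Definition total_fractions := {eq_quot fequiv}.
HB.instance Definition _ := EqQuotient.on total_fractions.
HB.instance Definition _ := Choice.on total_fractions.


Let addp s t : regular_pair :=
  pair_over (num s * den t + num t * den s) (lregM (@den_reg s) (@den_reg t)).
Let oppp s : regular_pair := pair_over (- num s) (@den_reg s).
Let mulp s t : regular_pair :=
  pair_over (num s * num t) (lregM (@den_reg s) (@den_reg t)).
Let cstp a : regular_pair := pair_over a (@lreg1 A).

Let tf := total_fractions.

Let piP s t : reflect (\pi_tf s = \pi_tf t) (num s * den t == num t * den s).
Proof. by apply: (iffP idP) => [h|/eqmodP //]; apply/eqmodP. Qed.

Let reprP s : num (repr (\pi_tf s)) * den s = num s * den (repr (\pi_tf s)).
Proof. by apply/eqP/piP; rewrite reprK. Qed.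

Definition tf_add (x y : tf) : tf := \pi_tf (addp (repr x) (repr y)).
Definition tf_opp (x : tf) : tf := \pi_tf (oppp (repr x)).
Definition tf_mul (x y : tf) : tf := \pi_tf (mulp (repr x) (repr y)).
Definition to_frac (a : A) : tf := \pi_tf (cstp a).

Let tf_addE s t : tf_add (\pi_tf s) (\pi_tf t) = \pi_tf (addp s t).
Proof.
apply/piP; rewrite !(numE, denE); apply/eqP.
have := reprP s; have := reprP t.
move: (repr (\pi_tf s)) (repr (\pi_tf t)) => s' t' ht hs.
rewrite !mulrDl; congr (_ + _).
  rewrite [LHS](_ : _ = (num s' * den s) * (den t' * den t)); last by ring.
  by rewrite hs; ring.
rewrite [LHS](_ : _ = (num t' * den t) * (den s' * den s)); last by ring.
by rewrite ht; ring.
Qed.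

Let tf_oppE s : tf_opp (\pi_tf s) = \pi_tf (oppp s).
Proof. by apply/piP; rewrite !(numE, denE) !mulNr reprP. Qed.

Let tf_mulE s t : tf_mul (\pi_tf s) (\pi_tf t) = \pi_tf (mulp s t).
Proof. by apply/piP; rewrite !(numE, denE) mulrACA !reprP mulrACA. Qed.

Let tf_addA : associative tf_add.
Proof.
elim/quotW=> s; elim/quotW=> t; elim/quotW=> u.
rewrite (tf_addE t u) (tf_addE s t) !tf_addE.
by apply/piP; rewrite !(numE, denE); apply/eqP; ring.
Qed.

Let tf_addC : commutative tf_add.
Proof.
elim/quotW=> s; elim/quotW=> t; rewrite !tf_addE.
by apply/piP; rewrite !(numE, denE); apply/eqP; ring.
Qed.

Let tf_add0 : left_id (to_frac 0) tf_add.
Proof.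
elim/quotW=> s; rewrite tf_addE.
by apply/piP; rewrite !(numE, denE); apply/eqP; ring.
Qed.

Let tf_addN : left_inverse (to_frac 0) tf_opp tf_add.
Proof.
elim/quotW=> s; rewrite tf_oppE tf_addE.
by apply/piP; rewrite !(numE, denE); apply/eqP; ring.
Qed.

HB.instance Definition _ :=
  GRing.isZmodule.Build total_fractions tf_addA tf_addC tf_add0 tf_addN.

Let tf_mulA : associative tf_mul.
Proof.
elim/quotW=> s; elim/quotW=> t; elim/quotW=> u.
rewrite (tf_mulE t u) (tf_mulE s t) !tf_mulE.
by apply/piP; rewrite !(numE, denE); apply/eqP; ring.
Qed.

Let tf_mulC : commutative tf_mul.
Proof.
elim/quotW=> s; elim/quotW=> t; rewrite !tf_mulE.
by apply/piP; rewrite !(numE, denE); apply/eqP; ring.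
Qed.

Let tf_mul1 : left_id (to_frac 1) tf_mul.
Proof.
elim/quotW=> s; rewrite tf_mulE.
by apply/piP; rewrite !(numE, denE); apply/eqP; ring.
Qed.

Let tf_mulD : left_distributive tf_mul tf_add.
Proof.
elim/quotW=> s; elim/quotW=> t; elim/quotW=> u.
rewrite (tf_addE s t) (tf_mulE s u) (tf_mulE t u) tf_mulE tf_addE.
by apply/piP; rewrite !(numE, denE); apply/eqP; ring.
Qed.

Let tf_1neq0 : to_frac 1 != to_frac 0.
Proof. by apply/eqP => /piP; rewrite !(numE, denE) !mulr1 oner_eq0. Qed.

HB.instance Definition _ := GRing.Zmodule_isComNzRing.Build total_fractions
  tf_mulA tf_mulC tf_mul1 tf_mulD tf_1neq0.

(* The inverse is chosen classically; it is the identity on non-units. *)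
Let tf_unit : {pred total_fractions} := fun x => `[< exists y, y * x = 1 >].
Definition tf_inv (x : total_fractions) : total_fractions :=
  if pselect (exists y, y * x = 1) is left h then sval (cid h) else x.

Let tf_mulV : {in tf_unit, left_inverse 1 tf_inv *%R}.
Proof.
move=> x /asboolP hx; rewrite /tf_inv; case: pselect => // h.
by case: (cid h).
Qed.

Let tf_unitP (x y : total_fractions) : y * x = 1 -> tf_unit x.
Proof. by move=> yx; apply/asboolP; exists y. Qed.

Let tf_inv_out : {in [predC tf_unit], tf_inv =1 id}.
Proof.
move=> x /negP hx; rewrite /tf_inv; case: pselect => // h.
by case: hx; apply/asboolP.
Qed.

HB.instance Definition _ := GRing.ComNzRing_hasMulInverse.Build total_fractions
  tf_mulV tf_unitP tf_inv_out.

Lemma to_frac_is_zmod_morphism : zmod_morphism to_frac.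
Proof.
move=> a b; transitivity (tf_add (to_frac a) (tf_opp (to_frac b))) => //.
rewrite tf_oppE tf_addE.
by apply/piP; rewrite !(numE, denE); apply/eqP; ring.
Qed.

Lemma to_frac_is_monoid_morphism : monoid_morphism to_frac.
Proof.
split=> // a b; transitivity (tf_mul (to_frac a) (to_frac b)) => //.
rewrite tf_mulE; by apply/piP; rewrite !(numE, denE); apply/eqP; ring.
Qed.

HB.instance Definition _ := GRing.isZmodMorphism.Build A total_fractions
  to_frac to_frac_is_zmod_morphism.
HB.instance Definition _ := GRing.isMonoidMorphism.Build A total_fractions
  to_frac to_frac_is_monoid_morphism.

Lemma to_frac_inj : injective to_frac.
Proof. by move=> a b /piP; rewrite !(numE, denE) !mulr1 => /eqP. Qed.

Lemma to_frac_unit (a : A) : GRing.lreg a -> to_frac a \is a GRing.unit.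
Proof.
move=> ha; apply/unitrP; exists (\pi_tf (pair_over 1 ha)).
have e : tf_mul (\pi_tf (pair_over 1 ha)) (to_frac a) = to_frac 1.
  rewrite tf_mulE; apply/piP; rewrite !(numE, denE); apply/eqP; ring.
by split=> //; rewrite mulrC.
Qed.

Lemma total_fractionsP (x : total_fractions) :
  exists a b, GRing.lreg b /\ x = to_frac a / to_frac b.
Proof.
elim/quotW: x => s; exists (num s), (den s); split; first exact: den_reg.
apply: (canRL (mulrK (to_frac_unit (@den_reg s)))).
transitivity (tf_mul (\pi_tf s) (to_frac (den s))) => //.
by rewrite tf_mulE; apply/piP; rewrite !(numE, denE); apply/eqP; ring.
Qed.

End TotalFractions.

Record ternary_form (R : comNzRingType) (d : nat) := TernaryForm {
  form_poly :> {mpoly R[3]};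
  form_homog : form_poly \is d.-homog;
  form_deg_gt0 : (0 < d)%N
}.

Section PlaneCurve.
Variables (R : comNzRingType) (d : nat) (F : ternary_form R d).

Definition curve_ideal : {pred {mpoly R[3]}} :=
  fun G => `[< exists H : {mpoly R[3]}, G = H * F >].

Lemma curve_ideal_closed : idealr_closed curve_ideal.
Proof.
split.
- by apply/asboolP; exists 0; rewrite mul0r.
- apply/negP => /asboolP [H] /(congr1 (mcoeff 0%MM)) /eqP.
  rewrite mcoeff1 eqxx (rmorphM (mcoeff 0%MM)) /=.
  have -> : F@_0%MM = 0.
    apply: (dhomog_nemf_coeff (form_homog F)).
    by rewrite mf0 eq_sym -lt0n (form_deg_gt0 F).
  by rewrite mulr0 oner_eq0.
- move=> a G1 G2 /asboolP [H1 ->] /asboolP [H2 ->]; apply/asboolP.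
  by exists (a * H1 + H2); rewrite mulrDl mulrA.
Qed.

HB.instance Definition _ :=
  isIdealr.Build {mpoly R[3]} curve_ideal curve_ideal_closed.

(* R[X,Y,Z]/(F) and its total ring of fractions, whose homogeneous elements of
   degree 0 are the rational functions on C. *)
Definition coord_ring := {ideal_quot curve_ideal}.
HB.instance Definition _ := GRing.ComNzRing.on coord_ring.

Definition to_coord (G : {mpoly R[3]}) : coord_ring := \pi_coord_ring G.

Definition frac_ring := total_fractions coord_ring.
HB.instance Definition _ := GRing.ComUnitRing.on frac_ring.

Definition cls (G : {mpoly R[3]}) : frac_ring := to_frac (to_coord G).

Definition rational_function (s : frac_ring) : Prop :=
  exists (e : nat) (A B : {mpoly R[3]}), [/\ A \is e.-homog, B \is e.-homog,
    GRing.lreg (to_coord B) & s = cls A / cls B].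

(* A point of the scheme C = Proj R[X,Y,Z]/(F), as a homogeneous prime ideal P
   of R[X,Y,Z] that contains F but not the irrelevant ideal (X,Y,Z). *)
Record curve_point (P : {mpoly R[3]} -> Prop) : Prop := CurvePoint {
  point0 : P 0;
  pointD : forall G H, P G -> P H -> P (G + H);
  pointM : forall G H, P H -> P (G * H);
  point1 : ~ P 1;
  point_prime : forall G H, P (G * H) -> P G \/ P H;
  point_homog : forall G e, P G -> P (pihomog mdeg e G);
  point_form : P F;
  point_relevant : exists i, ~ P 'X_i
}.

(* The Jacobian criterion on the charts X_i <> 0: the partial derivatives of
   the local equation F(X_0/X_i, X_1/X_i, X_2/X_i) with respect to the two
   coordinates X_j/X_i are the F_{X_j}/X_i^(d-1), and one of them has to be
   invertible at P. The points lie in both fibres of C over Spec R. *)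
Definition smooth_curve : Prop :=
  forall P, curve_point P -> forall i, ~ P 'X_i ->
    exists2 j, j != i & ~ P (F : {mpoly R[3]})^`M(j).

(* s = A/B in the local ring of C at P. *)
Definition regular_at (P : {mpoly R[3]} -> Prop) (s : frac_ring) : Prop :=
  exists (e : nat) (A B : {mpoly R[3]}), [/\ A \is e.-homog, B \is e.-homog, ~ P B
    & s * cls B = cls A].

Definition coordX : {mpoly R[3]} := 'X_(0 : 'I_3).
Definition coordY : {mpoly R[3]} := 'X_(1 : 'I_3).
Definition coordZ : {mpoly R[3]} := 'X_(2 : 'I_3).

(* The divisor C_oo = C . {Z = 0} has the local equation Z/X_i on the chart
   X_i <> 0. *)
Definition infinity_eq (i : 'I_3) : frac_ring := cls coordZ / cls 'X_i.

(* H^0(C, O_C(n C_oo)), as a set of rational functions on C. *)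
Definition sections_infinity (n : nat) (s : frac_ring) : Prop :=
  rational_function s /\
  forall P, curve_point P -> forall i, ~ P 'X_i ->
    regular_at P (s * infinity_eq i ^+ n).

Definition fun_x : frac_ring := cls coordX / cls coordZ.
Definition fun_y : frac_ring := cls coordY / cls coordZ.

Definition restrict (g : {mpoly R[2]}) : frac_ring :=
  mmap (fun c => cls c%:MP) (tnth [tuple fun_x; fun_y]) g.

Definition affine_eq : {mpoly R[2]} :=
  (F : {mpoly R[3]}) \mPo [tuple 'X_(0 : 'I_2); 'X_(1 : 'I_2); 1].

End PlaneCurve.

(* The submodule spanned by the x^i y^j with i + j <= e; it is 0 for e < 0. *)
Definition degree_le (R : comNzRingType) (e : int) (g : {mpoly R[2]}) : Prop :=
  forall m, m \in msupp g -> (mdeg m)%:Z <= e.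

(* Z divides the reduction of F; G lifts the quotient. *)
Definition reduction_divZ (p : nat) (K : padic_completion p)
    (L : fieldExtType (padic_field K)) (v : extended_valuation L)
    (F : {mpoly (valuation_ring v)[3]}) : Prop :=
  exists G, forall m, in_maximal_ideal (F - coordZ _ * G)@_m.

(* Main.v *)
(* With S = R[X,Y,Z], a section s of O(n C_oo) gives t = s Z^n, and the b in S
   with t b in S/(F) form an ideal that is contained in no point of C, hence
   contains a power of each variable. As Z does not divide F modulo the maximal
   ideal, F is nonzero on Z = 0, so Z is regular on S/(F), and no nonzero
   element of S/(F,Z) is killed by powers of both X and Y. Descending on the
   power of Z, this forces t to lie in S/(F); so s is the restriction of the
   dehomogenization of a form of degree n. Smoothness only ensures that X_i is
   regular on S/(F) as soon as some point of C lies off X_i = 0, so that the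
   local equation Z/X_i makes sense: a curve F = X_i G is singular where
   X_i = G = 0. *)
From HB Require Import structures.
Require Import Defs.
From mathcomp Require Import all_boot all_order all_algebra all_field.
From mathcomp Require Import boolp classical_sets ring.
From mathcomp Require Import mpoly.

Set Implicit Arguments.
Unset Strict Implicit.
Unset Printing Implicit Defensive.

Import Order.TTheory GRing.Theory Num.Theory.

Local Open Scope ring_scope.

(** * Prime ideals avoiding the powers of an element *)

Section PrimeAvoiding.
Variable A : comNzRingType.
Implicit Types (I J : A -> Prop) (x : A).

(** The unit ideal is allowed, unlike in [idealr_closed]: whether the ideals below are proper is
    what has to be decided. *)
Record is_ideal I : Prop := IsIdeal {
  ideal0 : I 0;
  idealD : forall a b, I a -> I b -> I (a + b);
  idealM : forall a b, I b -> I (a * b)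
}.

(** An ideal J maximal among those over I that miss the powers of x is prime: for a, b outside J,
    both J + (a) and J + (b) contain a power of x, and the product of these powers lies in J +
    (ab). *)
Lemma prime_avoiding I x : is_ideal I -> (forall N, ~ I (x ^+ N)) ->
  exists J, [/\ is_ideal J, forall a, I a -> J a,
    forall N, ~ J (x ^+ N) & forall a b, J (a * b) -> J a \/ J b].
Proof.
move=> [I0 ID IM] Ix.
(* The condition [J a -> I b -> J (a + b)] makes every nonempty member an ideal
   containing I, and holds for the empty set, the union of the empty chain. *)
pose Q (J : set A) := [/\ forall a b, J a -> J b -> J (a + b),
  forall a b, J b -> J (a * b), forall a b, J a -> I b -> J (a + b)
  & forall N, ~ J (x ^+ N)].
have [C FQ totC|J [[JD JM JI Jx] Jmax]] := @Zorn_bigcup A Q.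
  split=> [a b [X CX Xa] [Y CY Yb]|a b [X CX Xb]|a b [X CX Xa] Ib|N [X CX Xx]].
  - have [XY|YX] := totC _ _ CX CY.
      by exists Y => //; have [h _ _ _] := FQ _ CY; apply: h => //; apply: XY.
    by exists X => //; have [h _ _ _] := FQ _ CX; apply: h => //; apply: YX.
  - by exists X => //; have [_ h _ _] := FQ _ CX; apply: h.
  - by exists X => //; have [_ _ h _] := FQ _ CX; apply: h.
  - by have [_ _ _ h] := FQ _ CX; apply: (h N).
have Jne : exists a, J a.
  apply: contrapT => /forallNP Je; apply: (Jmax I); last by split.
  by split=> [a /Je //|h]; apply: (Je 0 (h 0 I0)).
have J0 : J 0 by have [a Ja] := Jne; rewrite -(mul0r a); apply: JM.
have power_in a : ~ J a -> exists N c u, J u /\ x ^+ N = u + c * a.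
  move=> Ja; apply: contrapT => none.
  apply: (Jmax (fun y => exists c u, J u /\ y = u + c * a)).
    split=> [y Jy|h]; first by exists 0, y; rewrite mul0r addr0.
    by apply: Ja; apply: h; exists 1, 0; rewrite mul1r add0r.
  split=> [_ _ [c [u [Ju ->]]] [c' [u' [Ju' ->]]]|b _ [c [u [Ju ->]]]
    |_ b [c [u [Ju ->]]] Ib|N [c [u [Ju e]]]].
  - by exists (c + c'), (u + u'); split; [apply: JD|ring].
  - by exists (b * c), (b * u); split; [apply: JM|ring].
  - by exists c, (u + b); split; [apply: JI|ring].
  - by apply: none; exists N, c, u.
exists J; split=> // [a Ia|a b Jab].
  by rewrite -(add0r a); apply: JI.
apply: contrapT => /not_orP [/power_in [N [c [u [Ju e]]]]].
move=> /power_in [M [c' [u' [Ju' e']]]]; apply: (Jx (N + M)%N).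
rewrite exprD e e'.
rewrite (_ : _ * _ = (u' + c' * b) * u + (c * a) * u' + (c * c') * (a * b));
  last by ring.
by apply: (JD); [apply: JD|]; apply: JM.
Qed.

End PrimeAvoiding.

(** * Homogeneous components of products *)

Section HomogeneousComponents.
Variables (n : nat) (R : comNzRingType).
Implicit Types (p q : {mpoly R[n]}) (m : 'X_{1..n}).

Lemma pihomogXM e m p : pihomog mdeg e ('X_[m] * p) =
  if (mdeg m <= e)%N then 'X_[m] * pihomog mdeg (e - mdeg m) p else 0.
Proof.
elim/mpolyind: p => [|c k p _ _ IH].
  by rewrite mulr0 !pihomog0 mulr0 if_same.
rewrite mulrDr !pihomogD IH -scalerAr -mpolyXD !linearZ /= !pihomogX /= mdegD.
case: leqP => [le|lt]; last first.
  by rewrite gtn_eqF ?scaler0 ?addr0 // ltn_addr.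
rewrite -[mdeg k == _](eqn_add2l (mdeg m)) subnKC // mulrDr; congr (_ + _).
by case: eqP => _; rewrite ?scaler0 ?mulr0 // -scalerAr mpolyXD.
Qed.

Lemma pihomogM e p q : pihomog mdeg e (p * q) =
  \sum_(k < e.+1) pihomog mdeg k p * pihomog mdeg (e - k) q.
Proof.
elim/mpolyind: p => [|c m p _ _ IH].
  by rewrite mul0r pihomog0 big1 // => k _; rewrite pihomog0 mul0r.
rewrite mulrDl pihomogD IH -scalerAl linearZ /= pihomogXM.
under [RHS]eq_bigr => k _ do rewrite pihomogD mulrDl linearZ /= pihomogX.
rewrite big_split /=; congr (_ + _).
case: leqP => [le|lt]; last first.
  rewrite scaler0 big1 // => k _; rewrite gtn_eqF ?scaler0 ?mul0r //.
  by apply: leq_trans lt; rewrite ltnS -ltnS.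
rewrite (bigD1 (Ordinal (le : (mdeg m < e.+1)%N))) //= eqxx -scalerAl.
rewrite big1 ?addr0 // => k; rewrite -val_eqE /= eq_sym => /negPf ->.
by rewrite scaler0 mul0r.
Qed.

(** Serves to cut an identity modulo a form down to a single degree. *)
Lemma pihomogM_dhomog d e p q : q \is d.-homog ->
  pihomog mdeg e (p * q) = if (d <= e)%N then pihomog mdeg (e - d) p * q else 0.
Proof.
move=> hq; rewrite pihomogM.
case: leqP => [le|lt]; last first.
  rewrite big1 // => k _; rewrite (pihomog_ne0 _ hq) ?mulr0 //.
  by rewrite gtn_eqF // (leq_ltn_trans _ lt) // leq_subr.
have lt : (e - d < e.+1)%N by rewrite ltnS leq_subr.
rewrite (bigD1 (Ordinal lt)) //= subKn // (pihomog_dE hq) //.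
rewrite big1 ?addr0 // => k; rewrite -val_eqE /= => ne.
rewrite (pihomog_ne0 _ hq) ?mulr0 //; apply: contra ne => /eqP ->.
by rewrite subKn // -ltnS.
Qed.

End HomogeneousComponents.

(** * Reduction modulo a variable *)

Section KillVariable.
Variables (n : nat) (R : comNzRingType) (i : 'I_n).
Implicit Types p q : {mpoly R[n]}.

(** The quotient by X_i is realized as the subring of polynomials free of X_i, so that cancellation
    takes place in the ambient ring. *)
Definition kill_var : {mpoly R[n]} -> {mpoly R[n]} :=
  comp_mpoly [tuple if j == i then 0 else 'X_j | j < n].

HB.instance Definition _ := GRing.RMorphism.on kill_var.

Lemma kill_varX j : kill_var 'X_j = if j == i then 0 else 'X_j.
Proof.
rewrite /kill_var comp_mpolyXU (nth_map j) ?size_enum_ord //.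
by rewrite nth_ord_enum.
Qed.

Lemma kill_varP p : exists q, p = kill_var p + 'X_i * q.
Proof.
elim/mpolyind: p => [|c m p _ _ [q Eq]].
  by exists 0; rewrite rmorph0 mulr0 addr0.
have [r Er] : exists r, 'X_[m] = kill_var 'X_[m] + 'X_i * r.
  rewrite mpolyXE_id rmorph_prod.
  elim/big_rec2: _ => [|j x y _ [r ->]]; first by exists 0; rewrite mulr0 addr0.
  rewrite rmorphXn /= kill_varX; case: eqVneq => [->|_]; last first.
    by exists ('X_j ^+ m j * r); rewrite mulrDr; congr (_ + _); ring.
  case: (m i) => [|k]; first by exists r; rewrite !expr0 !mul1r.
  exists ('X_i ^+ k * (y + 'X_i * r)).
  by rewrite !exprS !mul0r add0r mulrA.
exists (c *: r + q); rewrite rmorphD /= {1}Eq {1}Er /kill_var linearZ /=.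
by rewrite scalerDr mulrDr -scalerAr; ring.
Qed.

End KillVariable.

(** * Powers of distinct variables *)

Section CoprimeVariables.
Variables (n : nat) (R : comNzRingType).
Implicit Types p u w : {mpoly R[n]}.

Lemma mpolyXn_dvd j N p : (forall m : 'X_{1..n}, (m j < N)%N -> p@_m = 0) ->
  exists q, p = q * 'X_j ^+ N.
Proof.
(* The truncated subtraction loses nothing, as every monomial of the support has j-exponent at least
   N. *)
move=> hp; exists (\sum_(m <- msupp p) p@_m *: 'X_[m - U_(j) *+ N]).
rewrite {1}[p]mpolyE mulr_suml; apply: eq_big_seq => m mp.
rewrite -scalerAl mpolyXn -mpolyXD submK //.
apply/mnm_lepP => k; rewrite mulmnE mnm1E.
case: eqVneq => [<-|_]; rewrite ?mul0n // mul1n leqNgt.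
by apply: contraL mp => /hp; rewrite mcoeff_msupp => ->; rewrite eqxx.
Qed.

Lemma mcoeffMXn j N p (m : 'X_{1..n}) :
  (m j < N)%N -> (p * 'X_j ^+ N)@_m = 0.
Proof.
move=> lt; rewrite mpolyXn; apply: memN_msupp_eq0.
rewrite (perm_mem (msuppMX _ _)); apply/mapP => -[k _ Em].
by move: lt; rewrite Em mnmDE mulmnE mnm1E eqxx mul1n ltnNge leq_addr.
Qed.

(** The coefficient of u at m is that of w X_j^N at m + M e_k, where the j-exponent is still m_j; so
    it vanishes when m_j < N. *)
Lemma mpolyXn_coprime j k N M u w : j != k ->
  u * 'X_k ^+ M = w * 'X_j ^+ N -> exists u', u = u' * 'X_j ^+ N.
Proof.
move=> jk E; apply: mpolyXn_dvd => m lt.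
rewrite -(mcoeffMX u (U_(k) *+ M)) -mpolyXn E mcoeffMXn //.
by rewrite mnmDE mulmnE mnm1E [k == j]eq_sym (negPf jk) mul0n add0n.
Qed.

End CoprimeVariables.

(** * Depth of the polynomial ring modulo X_i and F *)

Section RegularSequence.
Variables (n : nat) (R : idomainType).
Implicit Types a F G u w : {mpoly R[n]}.

Lemma mpolyX_neq0 (m : 'X_{1..n}) : 'X_[m] != 0 :> {mpoly R[n]}.
Proof. by rewrite -msupp_eq0 msuppX. Qed.

(** Cancelling G gives u X_k^M = w X_j^N, so X_j^N divides u and can be cancelled in turn. *)
Lemma dvd_of_mulXn j k N M a G u w : j != k -> G != 0 ->
  a * 'X_j ^+ N = G * u -> a * 'X_k ^+ M = G * w -> exists u', a = G * u'.
Proof.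
move=> jk G0 Ej Ek.
have [|u' Eu] := @mpolyXn_coprime n R j k N M u w jk.
  by apply: (mulfI G0); rewrite !mulrA -Ej -Ek mulrAC.
exists u'; apply: (mulIf (mpolyX_neq0 (U_(j) *+ N))).
by rewrite -mpolyXn Ej Eu mulrA.
Qed.

(* If F is nonzero on the line X_i = 0, no nonzero element of S/(X_i, F) is
   killed by powers of both X_j and X_k. *)
Lemma depth_var i j k N M a F b b' h h' :
    j != i -> k != i -> j != k -> kill_var i F != 0 ->
    a * 'X_j ^+ N = 'X_i * b + F * h -> a * 'X_k ^+ M = 'X_i * b' + F * h' ->
  exists c u, a = 'X_i * c + F * u.
Proof.
move=> ji ki jk F0 Ej Ek.
have kill c g : kill_var i ('X_i * c + F * g) = kill_var i F * kill_var i g.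
  by rewrite rmorphD !rmorphM /= kill_varX eqxx mul0r add0r.
have := congr1 (kill_var i) Ej; have := congr1 (kill_var i) Ek.
rewrite !kill !rmorphM !rmorphXn /= !kill_varX (negPf ji) (negPf ki) => Ek' Ej'.
have [u Eu] := dvd_of_mulXn jk F0 Ej' Ek'.
have [c Ec] := kill_varP i a; have [f Ef] := kill_varP i F.
(* Replacing [kill_var i F] by F - X_i f in a = [kill_var i F] u + X_i c produces the term - f u. *)
exists (c - f * u), u; rewrite Ec Eu {2}Ef; ring.
Qed.

End RegularSequence.

(** * Points of the curve and its coordinate ring *)

Section PlaneCurveTheory.
Variables (R : comNzRingType) (d : nat) (F : ternary_form R d).
Implicit Types (G H K : {mpoly R[3]}) (P : {mpoly R[3]} -> Prop).

(* The homogeneous core of a prime J is prime: if neither G nor H lies in it,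
   look at the component of GH whose degree is the sum of the lowest degrees of
   the components of G and of H outside J. *)
Lemma curve_point_avoiding (I : {mpoly R[3]} -> Prop) (i : 'I_3) :
    is_ideal I -> I F -> (forall N, ~ I ('X_i ^+ N)) ->
  exists P, [/\ curve_point F P, ~ P 'X_i &
    forall e G, G \is e.-homog -> I G -> P G].
Proof.
move=> idI IF /(prime_avoiding idI) [J [[J0 JD JM] IJ JX Jprime]].
pose P G := forall e, J (pihomog mdeg e G).
have Phomog e G : G \is e.-homog -> J G -> P G.
  move=> hG JG k; case: (eqVneq e k) => [<-|ne]; first by rewrite pihomog_dE.
  by rewrite (pihomog_ne0 ne hG).
have J_sum (r : seq nat) (Q : pred nat) (f : nat -> {mpoly R[3]}) :
  (forall k, Q k -> J (f k)) -> J (\sum_(k <- r | Q k) f k) by exact: big_ind.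
have X1 j : ('X_j : {mpoly R[3]}) \is 1.-homog by rewrite dhomogX /= mdeg1.
have PX : ~ P 'X_i.
  by move=> /(_ 1%N); rewrite pihomog_dE // -[X in J X]expr1 => /JX.
have low G : ~ P G -> exists a, ~ J (pihomog mdeg a G) /\
    forall k, (k < a)%N -> J (pihomog mdeg k G).
  move=> /existsNP [e0 Je0].
  have ex : exists e, `[< ~ J (pihomog mdeg e G) >] by exists e0; apply/asboolP.
  exists (ex_minn ex); case: ex_minnP => a /asboolP Ja amin; split=> // k lt.
  apply: contrapT => Jk.
  by have := amin k (introT (asboolP _) Jk); rewrite leqNgt lt.
exists P; split=> //; last by move=> e G hG /IJ; apply: Phomog hG.
split.
- by move=> e; rewrite pihomog0.
- by move=> G H PG PH e; rewrite pihomogD; apply: JD.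
- move=> G H PH e; rewrite pihomogM.
  by elim/big_ind: _ => // k _; apply: (JM).
- by move=> /(_ 0%N); rewrite pihomog_dE ?dhomog1 // -(expr0 'X_i); apply: JX.
- move=> G H PGH; apply: contrapT => /not_orP [/low [a [Ja amin]]].
  move=> /low [b [Jb bmin]]; have := PGH (a + b)%N; rewrite pihomogM.
  have lt : (a < (a + b).+1)%N by rewrite ltnS leq_addr.
  rewrite (bigD1 (Ordinal lt)) //= addKn => Jsum.
  have [] // : J (pihomog mdeg a G) \/ J (pihomog mdeg b H).
  apply: Jprime; rewrite -[X in J X](addrK (\sum_(k < (a + b).+1 |
    k != Ordinal lt) pihomog mdeg k G * pihomog mdeg (a + b - k) H)).
  apply: (JD) => //; rewrite -mulN1r; apply: (JM).
  (* In every other term one factor has degree below the minimal one, so it lies in J. *)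
  elim/big_ind: _ => // k; rewrite -val_eqE /= neq_ltn => /orP [lt'|lt'].
    by rewrite mulrC; apply: (JM); apply: amin.
  apply: (JM); apply: bmin; rewrite ltn_subLR ?ltn_add2r //.
  by rewrite -ltnS.
- move=> G e PG k; apply: Phomog (PG e) k; exact: pihomogP.
- by apply: Phomog (form_homog F) _; apply: IJ.
- by exists i.
Qed.

Lemma curve_point_exp P (i : 'I_3) N : curve_point F P -> ~ P 'X_i ->
  ~ P ('X_i ^+ N).
Proof.
move=> pP Pi; elim: N => [|N IH]; first by rewrite expr0; exact: point1 pP.
by rewrite exprS => /(point_prime pP) [].
Qed.

Lemma to_coord_is_zmod_morphism : zmod_morphism (to_coord F).
Proof. by move=> G H; rewrite /to_coord rmorphB. Qed.

Lemma to_coord_is_monoid_morphism : monoid_morphism (to_coord F).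
Proof. by split=> [|G H]; rewrite /to_coord ?rmorph1 ?rmorphM. Qed.

HB.instance Definition _ := GRing.isZmodMorphism.Build {mpoly R[3]}
  (coord_ring F) (to_coord F) to_coord_is_zmod_morphism.
HB.instance Definition _ := GRing.isMonoidMorphism.Build {mpoly R[3]}
  (coord_ring F) (to_coord F) to_coord_is_monoid_morphism.
HB.instance Definition _ := GRing.RMorphism.copy (cls F)
  (@to_frac (coord_ring F) \o to_coord F).

Lemma to_coord_eq0 G : to_coord F G = 0 <-> exists H, G = H * F.
Proof.
have -> : (to_coord F G = 0) <-> (G \in curve_ideal F).
  rewrite -{2}[G]subr0 Quotient.idealrBE -(rmorph0 (to_coord F)).
  by split=> [E|/eqP//]; apply/eqP.
by split=> /asboolP.
Qed.

Lemma cls_eq0 G : cls F G = 0 <-> exists H, G = H * F.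
Proof.
rewrite -to_coord_eq0; split=> [|E]; last by rewrite /cls E rmorph0.
by rewrite -(rmorph0 (cls F)) => /to_frac_inj ->; rewrite rmorph0.
Qed.

Lemma lreg_to_coord G :
    (forall H K, H * G = K * F -> exists K' : {mpoly R[3]}, H = K' * F) ->
  GRing.lreg (to_coord F G).
Proof.
move=> reg x y; rewrite -[x]reprK -[y]reprK => /eqP.
rewrite -!(rmorphM (to_coord F)) -subr_eq0 -rmorphB -mulrBr mulrC => /eqP.
move=> /to_coord_eq0 [K /reg /to_coord_eq0 /eqP].
by rewrite rmorphB subr_eq0 => /eqP.
Qed.

End PlaneCurveTheory.

Lemma other_variables (i : 'I_3) : exists j k : 'I_3,
  [/\ j != i, k != i & j != k].
Proof.
case: i => [[|[|[|//]]] ?]; [exists 1, 2%R|exists 0, 2%R|exists 0, 1];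
  by rewrite -!val_eqE.
Qed.

(** * Smoothness and depth over a domain *)

Section IntegralCoefficients.
Variables (R : idomainType) (d : nat) (F : ternary_form R d).
Implicit Types (G H K : {mpoly R[3]}) (P : {mpoly R[3]} -> Prop).

(** Modulo X_i, the relation H X_i = K F kills K, because F is nonzero there; so X_i divides K and
    cancels. *)
Lemma lreg_variable (i : 'I_3) :
  kill_var i (F : {mpoly R[3]}) != 0 -> GRing.lreg (to_coord F 'X_i).
Proof.
move=> F0; apply: lreg_to_coord => H K E.
have [K' EK] := kill_varP i K.
have /eqP := congr1 (kill_var i) E.
rewrite !rmorphM /= kill_varX eqxx mulr0 eq_sym mulf_eq0 (negPf F0) orbF.
move=> /eqP K0; exists K'; apply: (mulIf (mpolyX_neq0 R U_(i)%MM)).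
by rewrite E EK K0 add0r; ring.
Qed.

(* A curve F = X_i G is singular where the line X_i = 0 meets G = 0; when they
   do not meet, G is a unit and C is the line X_i = 0 itself. *)
Lemma smooth_not_divisible P (i : 'I_3) : smooth_curve F -> curve_point F P ->
  ~ P 'X_i -> kill_var i (F : {mpoly R[3]}) != 0.
Proof.
move=> smooth pP Pi; apply/eqP => F0.
have [G] := kill_varP i F; rewrite F0 add0r => EF.
have hG : G \is d.-1.-homog.
  suff -> : G = pihomog mdeg d.-1 G by exact: pihomogP.
  apply: (mulfI (mpolyX_neq0 R U_(i)%MM)); rewrite -EF.
  rewrite -[LHS](pihomog_dE (form_homog F)) EF pihomogXM mdeg1.
  by rewrite (form_deg_gt0 F) subn1.
pose I H := exists a b, H = 'X_i * a + G * b.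
have idI : is_ideal I.
  split=> [|_ _ [a [b ->]] [a' [b' ->]]|c _ [a [b ->]]].
  - by exists 0, 0; rewrite !mulr0 addr0.
  - by exists (a + a'), (b + b'); ring.
  - by exists (c * a), (c * b); ring.
(* At a point with X_i = G = 0 the Leibniz rule makes every partial derivative of X_i G vanish,
   against smoothness. *)
have nilp j : j != i -> exists N, I ('X_j ^+ N).
  move=> ji; apply: contrapT => /forallNP noN.
  have IF : I F by exists G, 0; rewrite mulr0 addr0.
  have [P' [pP' P'j IP']] := curve_point_avoiding idI IF noN.
  have P'i : P' 'X_i.
    by apply: (IP' 1%N); [rewrite dhomogX /= mdeg1|exists 1, 0; ring].
  have P'G : P' G by apply: (IP' d.-1) => //; exists 0, 1; ring.
  have [l _ []] := smooth _ pP' _ P'j.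
  rewrite EF mderivM; apply: (pointD pP'); first exact: (pointM pP').
  by rewrite mulrC; apply: (pointM pP').
have [j [k [ji ki jk]]] := other_variables i.
have [N [a [b E]]] := nilp _ ji; have [M [a' [b' E']]] := nilp _ ki.
have G0 : kill_var i G != 0.
  apply/eqP => G0; have /eqP := congr1 (kill_var i) E.
  rewrite rmorphD !rmorphM rmorphXn /= !kill_varX eqxx (negPf ji) G0.
  rewrite !mul0r addr0.
  by rewrite expf_eq0 (negPf (mpolyX_neq0 R U_(j)%MM)) andbF.
(* With a = 1, [depth_var] puts 1 into (X_i, G); the constant terms then show that the constant term
   of G is a unit. *)
rewrite -[LHS]mul1r in E; rewrite -[LHS]mul1r in E'.
have [c [u /(congr1 (mcoeff 0%MM))]] := depth_var ji ki jk G0 E E'.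
have X0 : ('X_i : {mpoly R[3]})@_0%MM = 0.
  by rewrite mcoeffX; case: eqP => // /(congr1 (@mdeg _)); rewrite mdeg1 mdeg0.
rewrite mcoeff1 eqxx rmorphD !(rmorphM (mcoeff 0%MM)) /= X0 mul0r add0r => E1.
have d0 : d.-1 = 0%N.
  apply/eqP; apply: contraT => d0; move/eqP: E1.
  rewrite (dhomog_nemf_coeff hG) ?mul0r ?oner_eq0 //.
  by rewrite mf0 eq_sym.
have GC : G = (G@_0%MM)%:MP.
  apply/mpolyP => m; rewrite mcoeffC; case: eqVneq => [->|m0].
    by rewrite mulr1.
  by rewrite mulr0 (dhomog_nemf_coeff hG) // d0 mdeg_eq0.
(* G is now a unit constant, so X_i is a multiple of F and would lie in P. *)
have EX : (u@_0%MM)%:MP * (F : {mpoly R[3]}) = 'X_i.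
  rewrite EF {1}GC mulrCA -rmorphM /= mulrC [u@__ * _]mulrC -E1.
  by rewrite rmorph1 mul1r.
by apply: Pi; rewrite -EX; apply: (pointM pP); apply: (point_form pP).
Qed.

Lemma cls_unit (i : 'I_3) : kill_var i (F : {mpoly R[3]}) != 0 ->
  cls F 'X_i \is a GRing.unit.
Proof. by move=> /lreg_variable; exact: to_frac_unit. Qed.

(* If t Z, t X^N and t Y^M are regular, then t Z is killed by X^N and Y^M
   modulo Z, hence is divisible by Z. *)
Lemma depth_step (i j k : 'I_3) N M t :
    j != i -> k != i -> j != k -> kill_var i (F : {mpoly R[3]}) != 0 ->
    (exists G, t * cls F 'X_i = cls F G) ->
    (exists G, t * cls F 'X_j ^+ N = cls F G) ->
    (exists G, t * cls F 'X_k ^+ M = cls F G) ->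
  exists G, t = cls F G.
Proof.
move=> ji ki jk F0 [a Ea] [b Eb] [c Ec].
have lift l L g : t * cls F 'X_l ^+ L = cls F g ->
    exists h, a * 'X_l ^+ L = 'X_i * g + (F : {mpoly R[3]}) * h.
  move=> E; have /cls_eq0 [h Eh] : cls F (a * 'X_l ^+ L - 'X_i * g) = 0.
    by rewrite rmorphB !rmorphM rmorphXn /= -Ea -E; ring.
  by exists h; rewrite [_ * h]mulrC -Eh; ring.
have [h Eh] := lift _ _ _ Eb; have [h' Eh'] := lift _ _ _ Ec.
have [g [u Eg]] := depth_var ji ki jk F0 Eh Eh'; exists g.
apply: (mulIr (cls_unit F0)); rewrite Ea Eg rmorphD !rmorphM /=.
have -> : cls F F = 0 by apply/cls_eq0; exists 1; rewrite mul1r.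
by rewrite mul0r addr0 mulrC.
Qed.

(** Descent on the exponent of X_i: [depth_step], applied to t X_i^L, lowers it by one. *)
Lemma depth_extend (i : 'I_3) t : kill_var i (F : {mpoly R[3]}) != 0 ->
    (forall j, exists N G, t * cls F 'X_j ^+ N = cls F G) ->
  exists G, t = cls F G.
Proof.
move=> F0 tX; have [j [k [ji ki jk]]] := other_variables i.
have [N [g Eg]] := tX j; have [M [h Eh]] := tX k; have [L [q Eq]] := tX i.
elim: L q Eq => [|L IH] q Eq; first by exists q; rewrite -Eq expr0 mulr1.
have [G EG] : exists G, t * cls F 'X_i ^+ L = cls F G; last exact: IH EG.
apply: (@depth_step i j k N M) => //.
- by exists q; rewrite -Eq exprSr mulrA.
- by exists (g * 'X_i ^+ L); rewrite rmorphM rmorphXn /= -Eg mulrAC.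
- by exists (h * 'X_i ^+ L); rewrite rmorphM rmorphXn /= -Eh mulrAC.
Qed.

End IntegralCoefficients.

(** * Dehomogenization and homogenization *)

Section Dehomogenization.
Variable R : comNzRingType.
Implicit Types (G : {mpoly R[3]}) (g : {mpoly R[2]}).

(** Same substitution as in [affine_eq], so [affine_eq F] and [dehomog F] are convertible. *)
Definition dehomog : {mpoly R[3]} -> {mpoly R[2]} :=
  comp_mpoly [tuple 'X_(0 : 'I_2); 'X_(1 : 'I_2); 1].

HB.instance Definition _ := GRing.RMorphism.on dehomog.

Lemma dehomogXm (m : 'X_{1..3}) :
  dehomog 'X_[m] = 'X_[U_(0%R) *+ m 0%R + U_(1%R) *+ m 1%R].
Proof.
rewrite /dehomog comp_mpolyX !big_ord_recl big_ord0 mpolyXD -!mpolyXn.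
rewrite !(tnth_nth 0) /= expr1n !mulr1.
by congr (_ ^+ _ * _ ^+ _); congr (m _); apply: val_inj.
Qed.

Lemma dehomogE G :
  dehomog G = \sum_(m <- msupp G)
    G@_m *: 'X_[U_(0%R) *+ m 0%R + U_(1%R) *+ m 1%R].
Proof.
by rewrite {1}/dehomog comp_mpolyEX; apply: eq_bigr => m _; rewrite -dehomogXm.
Qed.

Lemma mdeg3 (m : 'X_{1..3}) : mdeg m = (m 0%R + m 1%R + m 2%R)%N.
Proof.
rewrite mdegE !big_ord_recl big_ord0 addn0 addnA.
by congr (_ + _ + _)%N; congr (m _); apply: val_inj.
Qed.

Lemma degree_le_dehomog e G : G \is e.-homog -> degree_le e%:Z (dehomog G).
Proof.
move=> hG m; rewrite lez_nat; apply: contraTT; rewrite -ltnNge => lt.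
rewrite mcoeff_msupp negbK dehomogE raddf_sum /= big_seq.
apply/eqP/big1 => k kG; rewrite mcoeffZ mcoeffX.
case: eqP => [Em|]; last by rewrite mulr0.
have := dhomog_mf hG kG; move: lt; rewrite -Em /= mdegD !mdegMn !mdeg1 !mul1n.
by rewrite mdeg3 => lt Ee; move: lt; rewrite -Ee ltnNge leq_addr.
Qed.

Lemma homogenization n g : degree_le n%:Z g ->
  exists2 G, G \is n.-homog & dehomog G = g.
Proof.
(* Each monomial is filled up to degree n with Z; the degree bound keeps [n - mdeg m] exact. *)
move=> dg; exists (\sum_(m <- msupp g) g@_m *:
  'X_[U_(0%R) *+ m 0%R + U_(1%R) *+ m 1%R + U_(2%R) *+ (n - mdeg m)]).
  rewrite big_seq; apply: rpred_sum => m /dg; rewrite lez_nat => le.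
  apply: rpredZ; rewrite dhomogX /= !mdegD !mdegMn !mdeg1 !mul1n.
  rewrite -{2}(subnKC le).
  rewrite mdegE !big_ord_recl big_ord0 addn0; apply/eqP.
  by congr (_ + _ + _)%N; congr (m _); apply: val_inj.
rewrite rmorph_sum [RHS]mpolyE; apply: eq_bigr => m _.
rewrite /= {1}/dehomog comp_mpolyZ -/(dehomog _) dehomogXm; congr (_ *: 'X_[_]).
by apply/mnmP; case=> [[|[|//]] ?]; rewrite !mnmDE !mulmnE !mnm1E /= ?mulnDl
  ?(mul0n, mul1n, addn0, add0n); congr (m _); apply: val_inj.
Qed.

Lemma morph_mmap (n : nat) (S : comNzRingType)
    (phi : {rmorphism {mpoly R[n]} -> S}) (p : {mpoly R[n]}) :
  mmap (phi \o @mpolyC n R) (fun i => phi 'X_i) p = phi p.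
Proof.
rewrite [in RHS](mpolyE p) rmorph_sum; apply: eq_bigr => m _.
by rewrite -mul_mpolyC rmorphM mpolyXE_id rmorph_prod /=; congr (_ * _);
  apply: eq_bigr => i _; rewrite rmorphXn.
Qed.

Lemma mmap1_3 (S : comNzRingType) (h : 'I_3 -> S) (m : 'X_{1..3}) :
  mmap1 h m = h 0 ^+ m 0%R * h 1 ^+ m 1%R * h 2%R ^+ m 2%R.
Proof.
rewrite /mmap1 !big_ord_recl big_ord0 mulr1 mulrA.
by congr (_ ^+ _ * _ ^+ _ * _ ^+ _); (congr h || congr (m _)); apply: val_inj.
Qed.

(** For a + b + c = e one has X^a Y^b Z^c = Z^e (X/Z)^a (Y/Z)^b. The target is general in order to
    cover both the fractions on C and those of R[X,Y,Z]. *)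
Lemma mmap_dehomog (S : comUnitRingType)
    (phi : {rmorphism {mpoly R[3]} -> S}) e G :
    G \is e.-homog -> phi 'X_(2 : 'I_3) \is a GRing.unit ->
  phi 'X_(2 : 'I_3) ^+ e * mmap (phi \o @mpolyC 3 R)
    (tnth [tuple phi 'X_(0 : 'I_3) / phi 'X_(2 : 'I_3);
                 phi 'X_(1 : 'I_3) / phi 'X_(2 : 'I_3)]) (dehomog G) = phi G.
Proof.
move=> hG; rewrite dehomogE raddf_sum mulr_sumr => uZ.
rewrite -[RHS]morph_mmap [RHS]big_seq [LHS]big_seq; apply: eq_bigr => m mG.
rewrite -(dhomog_mf hG mG) /= mmapZ mulrCA; congr (_ * _).
rewrite mpolyXD -!mpolyXn rmorphM !rmorphXn /=.
rewrite !mmapX !mmap1U !(tnth_nth 0) /= mdeg3 mmap1_3.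
move: (phi 'X_0) (phi 'X_1) (phi 'X_2) uZ => x y z uz.
rewrite !exprD mulrAC; congr (_ * _).
by rewrite mulrACA -!exprMn ![z * (_ / z)]mulrC !divrK.
Qed.

End Dehomogenization.

(** * Restriction of affine polynomials to the curve *)

Section Restriction.
Variables (R : comNzRingType) (d : nat) (F : ternary_form R d).

HB.instance Definition _ := GRing.RMorphism.copy (restrict F)
  (mmap (cls F \o @mpolyC 3 R) (tnth [tuple fun_x F; fun_y F])).

Lemma restrict_dehomog e (G : {mpoly R[3]}) :
    cls F (coordZ R) \is a GRing.unit -> G \is e.-homog ->
  cls F (coordZ R) ^+ e * restrict F (dehomog G) = cls F G.
Proof. by move=> uZ hG; apply: mmap_dehomog. Qed.

Lemma restrict_affine_eq : cls F (coordZ R) \is a GRing.unit ->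
  restrict F (affine_eq F) = 0.
Proof.
move=> uZ; have := restrict_dehomog uZ (form_homog F).
have -> : cls F F = 0 by apply/cls_eq0; exists 1; rewrite mul1r.
move=> E; apply: (mulrI (unitrX d uZ)); rewrite mulr0; exact: E.
Qed.

End Restriction.

(** * Sections with poles at infinity *)

Section SectionsAtInfinity.
Variables (R : idomainType) (d : nat) (F : ternary_form R d).
Hypothesis F0 : kill_var (2 : 'I_3) (F : {mpoly R[3]}) != 0.

(** In the fraction field of R[X,Y,Z], G is Z^e times its dehomogenization at (X/Z, Y/Z). *)
Lemma dehomog_eq0 e (G : {mpoly R[3]}) : G \is e.-homog ->
  dehomog G = 0 -> G = 0.
Proof.
move=> hG G0.
have uZ : @tofrac {mpoly R[3]} 'X_(2 : 'I_3) \is a GRing.unit.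
  by rewrite unitfE tofrac_eq0 mpolyX_neq0.
have := mmap_dehomog hG uZ; rewrite G0 mmap0 mulr0 => /esym/eqP.
by rewrite tofrac_eq0 => /eqP.
Qed.

Let uZ : cls F (coordZ R) \is a GRing.unit := cls_unit F0.

Lemma affine_eq_neq0 : affine_eq F != 0.
Proof.
apply: contra F0 => /eqP E.
have -> : (F : {mpoly R[3]}) = 0 by apply: dehomog_eq0 (form_homog F) E.
by rewrite rmorph0.
Qed.

(* The denominators of [s Z^n] form an ideal that lies in no point of the curve,
   so it contains a power of each variable. *)
Lemma section_regular n s : smooth_curve F -> sections_infinity n s ->
  exists G, s * cls F (coordZ R) ^+ n = cls F G.
Proof.
move=> smooth [_ reg]; apply: (depth_extend F0) => j.
set t := s * _; apply: contrapT => /forallNP noN.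
pose I b := exists G, t * cls F b = cls F G.
have idI : is_ideal I.
  split=> [|a b [G EG] [H EH]|a b [G EG]].
  - by exists 0; rewrite rmorph0 mulr0.
  - by exists (G + H); rewrite !rmorphD mulrDr EG EH.
  - by exists (a * G); rewrite !rmorphM mulrCA EG.
have IF : I F.
  exists 0; rewrite rmorph0 (_ : cls F F = 0) ?mulr0 //.
  by apply/cls_eq0; exists 1; rewrite mul1r.
have noI N : ~ I ('X_j ^+ N).
  by move=> [G]; rewrite rmorphXn => EG; apply: (noN N); exists G.
have [P [pP Pj IP]] := curve_point_avoiding idI IF noI.
have [e [A [B [_ hB PB E]]]] := reg _ pP _ Pj.
(* Clearing X_j^n from s (Z/X_j)^n B = A gives t B = A X_j^n, so the form B lies in I and hence in
   P. *)
apply: PB; apply: IP hB _; exists (A * 'X_j ^+ n).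
have uj := cls_unit (smooth_not_divisible smooth pP Pj).
rewrite rmorphM rmorphXn /= -E /infinity_eq exprMn exprVn.
rewrite /t [RHS]mulrAC mulrA; congr (_ * _).
by rewrite mulrVK // unitrX.
Qed.

Lemma sections_infinityP n s : smooth_curve F -> sections_infinity n s <->
  exists2 g : {mpoly R[2]}, degree_le n%:Z g & restrict F g = s.
Proof.
move=> smooth; split=> [sec|[g /homogenization [G hG <-] <-]]; last first.
  (* The homogenization G represents s as G/Z^n, and s (Z/X_i)^n as G/X_i^n at points off X_i =
     0. *)
  have E := restrict_dehomog uZ hG; split.
    exists n, G, (coordZ R ^+ n); split=> //.
    - by rewrite -[n in n.-homog]mul1n; apply: dhomogMn;
        rewrite dhomogX /= mdeg1.
    - by rewrite rmorphXn; apply: lregX; apply: lreg_variable.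
    - by rewrite rmorphXn /= -E mulrC mulKr // unitrX.
  move=> P pP i Pi; exists n, G, ('X_i ^+ n); split=> //.
  - by rewrite -[n in n.-homog]mul1n; apply: dhomogMn; rewrite dhomogX /= mdeg1.
  - exact: curve_point_exp pP Pi.
  - have ui := cls_unit (smooth_not_divisible smooth pP Pi).
    rewrite rmorphXn /= /infinity_eq exprMn exprVn -mulrA mulrVK ?unitrX //.
    by rewrite mulrC.
have [G EG] := section_regular smooth sec.
have [[e [A [B [hA hB rB Es]]]] _] := sec.
have uB : cls F B \is a GRing.unit by exact: to_frac_unit.
have hZ : (coordZ R ^+ n) \is n.-homog.
  by rewrite -[n in n.-homog]mul1n; apply: dhomogMn; rewrite dhomogX /= mdeg1.
have /cls_eq0 [H EH] : cls F (coordZ R ^+ n * A - G * B) = 0.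
  by rewrite rmorphB !rmorphM rmorphXn /= -EG Es mulrAC divrK // mulrC subrr.
(* G need not be homogeneous; as A and B are forms of the same degree e, the component of degree n +
   e replaces G by its part of degree n. *)
have [H' EH'] : exists H' : {mpoly R[3]},
    coordZ R ^+ n * A - pihomog mdeg n G * B = H' * F.
  have := congr1 (pihomog mdeg (n + e)) EH.
  rewrite pihomogB (pihomog_dE (dhomogM hZ hA)) (pihomogM_dhomog _ _ hB).
  rewrite leq_addl addnK (pihomogM_dhomog _ _ (form_homog F)) => ->.
  by case: ifP => _; [eexists|exists 0; rewrite mul0r].
have EG' : cls F (pihomog mdeg n G) = cls F (coordZ R) ^+ n * s.
  apply: (mulIr uB); rewrite -rmorphM -mulrA Es divrK // -rmorphXn -rmorphM.
  by apply/esym/eqP; rewrite -subr_eq0 -rmorphB; apply/eqP/cls_eq0; exists H'.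
exists (dehomog (pihomog mdeg n G)).
  by apply: degree_le_dehomog; apply: pihomogP.
apply: (mulrI (unitrX n uZ)); rewrite -EG'.
by apply: restrict_dehomog => //; apply: pihomogP.
Qed.

(** A homogenization of g is a multiple of F, and the cofactor, cut to degree n - d, dehomogenizes
    to h. Uniqueness of h makes the sum of the R f x^i y^j direct. *)
Lemma restrict_eq0P n (g : {mpoly R[2]}) : degree_le n%:Z g ->
  restrict F g = 0 <-> exists! h : {mpoly R[2]},
    degree_le (n%:Z - d%:Z) h /\ g = affine_eq F * h.
Proof.
move=> dg; split=> [g0|[h [[_ ->] _]]]; last first.
  by rewrite rmorphM /= restrict_affine_eq // mul0r.
have [h [dh Eh]] : exists h, degree_le (n%:Z - d%:Z) h /\ g = affine_eq F * h.
  have [G hG EG] := homogenization dg.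
  have /cls_eq0 [H EH] : cls F G = 0.
    by rewrite -(restrict_dehomog uZ hG) EG g0 mulr0.
  have := congr1 (pihomog mdeg n) EH; rewrite (pihomog_dE hG).
  rewrite (pihomogM_dhomog _ _ (form_homog F)); case: leqP => [le|_] EG'.
    exists (dehomog (pihomog mdeg (n - d) H)); split.
      by rewrite subzn //; apply: degree_le_dehomog; apply: pihomogP.
    by rewrite -EG EG' rmorphM mulrC.
  (* For n < d a multiple of F has no component of degree n, so g = 0. *)
  exists 0; split; first by move=> m; rewrite msupp0.
  by rewrite mulr0 -EG EG' rmorph0.
exists h; split=> // h' [_ Eh']; apply: (mulfI affine_eq_neq0).
by rewrite -Eh -Eh'.
Qed.

End SectionsAtInfinity.

(** * The valuation ring as an integral domain *)

Section ValuationRingDomain.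
Variables (p : nat) (K : padic_completion p).
Variables (L : fieldExtType (padic_field K)) (v : extended_valuation L).
Implicit Types x y : valuation_ring v.

Let unit : {pred valuation_ring v} :=
  fun x => (val x != 0) && ((val x)^-1 \in in_valuation_ring v).
Let inv x : valuation_ring v := insubd x (val x)^-1.

Let mulV : {in unit, left_inverse 1 inv *%R}.
Proof.
move=> x /andP [x0 xV]; apply: val_inj.
by rewrite rmorphM rmorph1 /= val_insubd xV mulVf.
Qed.

Let unitP x y : y * x = 1 -> unit x.
Proof.
move=> /(congr1 val); rewrite rmorphM rmorph1 /= => yx.
have x0 : val x != 0.
  by apply/eqP => x0; move/eqP: yx; rewrite x0 mulr0 eq_sym oner_eq0.
by rewrite /unit x0 (_ : (val x)^-1 = val y) ?(valP y) // -[LHS]mul1r -yx mulfK.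
Qed.

Let inv_out : {in [predC unit], inv =1 id}.
Proof.
move=> x; rewrite inE /= unfold_in /= negb_and negbK => /orP [/eqP x0|xV].
  by apply: val_inj; rewrite val_insubd /= x0 invr0 if_same.
by apply: val_inj; rewrite val_insubd /= (negPf xV).
Qed.

HB.instance Definition _ := GRing.ComNzRing_hasMulInverse.Build
  (valuation_ring v) mulV unitP inv_out.

Let integral x y : x * y = 0 -> (x == 0) || (y == 0).
Proof.
move=> /(congr1 val) /eqP; rewrite rmorphM rmorph0 /= mulf_eq0.
by rewrite -!(inj_eq val_inj) rmorph0.
Qed.

HB.instance Definition _ := GRing.ComUnitRing_isIntegral.Build
  (valuation_ring v) integral.

(** If F vanished on Z = 0 already over R, then F = Z G exactly, and Z would divide the
    reduction. *)
Lemma kill_var_reduction (F : {mpoly (valuation_ring v)[3]}) :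
  ~ reduction_divZ F -> kill_var (2 : 'I_3) F != 0.
Proof.
move=> hF; apply/eqP => F0; apply: hF; have [G] := kill_varP 2%R F.
by rewrite F0 add0r => EF; exists G => m; rewrite {1}EF subrr mcoeff0; left.
Qed.

End ValuationRingDomain.

Theorem proposition13p12 (p : nat) (hp : prime p) (K : padic_completion p)
    (L : fieldExtType (padic_field K)) (v : extended_valuation L)
    (d : nat) (F : ternary_form (valuation_ring v) d)
    (hsmooth : smooth_curve F) (hred : ~ reduction_divZ F)
    (n : nat) (hn1 : (1 <= n)%N) (hnd : d%:Z - 2 <= n%:Z) :
  (forall s : frac_ring F,
     sections_infinity n s <->
     exists2 g : {mpoly (valuation_ring v)[2]},
       degree_le n%:Z g & restrict F g = s) /\
  (forall g : {mpoly (valuation_ring v)[2]}, degree_le n%:Z g ->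
     (restrict F g = 0 <->
      exists! h : {mpoly (valuation_ring v)[2]},
        degree_le (n%:Z - d%:Z) h /\ g = affine_eq F * h)).
Proof.
have F0 := kill_var_reduction hred.
by split=> [s|g]; [apply: sections_infinityP|apply: restrict_eq0P].
Qed.
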